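(* Let $k$ be a field. There exists a finite simple chordal graph $G$, with vertex set $V_G=\{x_1,\ldots,x_n\}$ for some $n$ and edge set $E_G$, such that for every integer $t>1$ the ideal $$\bigcap_{\{x_i,x_j\}\in E_G}\langle x_i,x_j\rangle^{t}\subset k[x_1,\ldots,x_n]$$ is not componentwise linear.
   Context: A simple undirected graph $G$ is chordal if every cycle of length $m\geq 4$ in $G$ has a chord. The vertices of $G$ are identified with the variables of the polynomial ring $R=k[x_1,\ldots,x_n]$, which carries its standard grading ($\deg x_i=1$). For a graded ideal $I\subset R$ and an integer $d$, $I_{\langle d\rangle}$ denotes the ideal generated by the elements of degree $d$ that belong to $I$. A graded ideal $I\subset R$ is called componentwise linear if $I_{\langle d\rangle}$ has a linear resolution for all $d$. Here a graded ideal $J$ generated in degree $d$ has a linear resolution if $\operatorname{Tor}_i^R(J,k)_{i+j}=0$ for all $i\geq 0$ and all $j\neq d$ (equivalently, in the minimal graded free resolution of $J$ the $i$-th free module is generated in degree $d+i$ for all $i$); the zero ideal satisfies this trivially. *)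

(* Defs.v *)
From mathcomp Require Import all_boot all_order all_algebra.
From mathcomp Require Import mpoly.
Set Implicit Arguments.
Unset Strict Implicit.
Unset Printing Implicit Defensive.
Import GRing.Theory.
Local Open Scope ring_scope.

(* ---- Chordal graphs ------------------------------------------------------ *)

(* Duplicate-free edge cycles of size m are the cycles of length m; an edge
   between two vertices of [c] is a chord when it is not an edge of [c], i.e.
   when neither end follows the other in cyclic order. *)
Definition chordal (T : finType) (E : rel T) : Prop :=
  forall c : seq T, uniq c -> cycle E c -> (4 <= size c)%N ->
  exists x y, [/\ x \in c, y \in c, E x y, y != next c x & x != next c y].

(* ---- Ideals, as predicates ----------------------------------------------- *)

Definition ideal_gen (A : comNzRingType) (S : A -> Prop) : A -> Prop :=
  fun f => exists (m : nat) (c g : 'I_m -> A),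
    (forall l, S (g l)) /\ f = \sum_(l < m) c l * g l.

Definition ideal_pow (A : comNzRingType) (I : A -> Prop) (t : nat) :
    A -> Prop :=
  ideal_gen (fun f => exists g : 'I_t -> A,
    (forall l, I (g l)) /\ f = \prod_(l < t) g l).

Section Graded.
Variables (k : fieldType) (n : nat).
Local Notation R := {mpoly k[n]}.

Definition edge_ideal_pow_inter (E : rel 'I_n) (t : nat) : R -> Prop :=
  fun f => forall i j : 'I_n, E i j ->
    ideal_pow (ideal_gen (fun g : R => g = 'X_i \/ g = 'X_j)) t f.

(* I_<d> *)
Definition ideal_component (I : R -> Prop) (d : nat) : R -> Prop :=
  ideal_gen (fun f : R => I f /\ f \is d.-homog).

(* ---- Graded free resolutions and Tor_i(J, k) ----------------------------- *)

(* F_i = 'rV[R]_(rk i) is the free module whose a-th basis vector sits in degree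
   [deg a]; the maps F_(i+1) -> F_i and F_0 -> R are v |-> v *m diff i and
   v |-> v *m aug.  Degrees in nat suffice: a minimal resolution of an ideal
   of R has no generator of negative degree. *)
Record free_complex := FreeComplex {
  rk : nat -> nat;
  deg : forall i, 'I_(rk i) -> nat;
  diff : forall i, 'M[R]_(rk i.+1, rk i);
  aug : 'cV[R]_(rk 0)
}.

(* The maps preserve degrees. *)
Definition is_graded (F : free_complex) : Prop :=
  (forall a, aug F a 0 \is (deg a).-homog) /\
  (forall i (a : 'I_(rk F i.+1)) (b : 'I_(rk F i)),
     if (deg b <= deg a)%N then diff F i a b \is (deg a - deg b).-homog
     else diff F i a b == 0).

Definition graded_free_resolution (F : free_complex) (J : R -> Prop) : Prop :=
  [/\ is_graded F,
      forall f : R, J f <-> exists v : 'rV_(rk F 0), (v *m aug F) 0 0 = f,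
      forall v : 'rV_(rk F 0),
        v *m aug F = 0 <-> exists w : 'rV_(rk F 1), w *m diff F 0 = v
    & forall i (v : 'rV_(rk F i.+1)),
        v *m diff F i = 0 <-> exists w : 'rV_(rk F i.+2), w *m diff F i.+1 = v].

(* The differential of the complex F (x)_R k, where k = R / (x_1, ..., x_n):
   entries are reduced to their constant coefficient. *)
Definition diffk (F : free_complex) i : 'M[k]_(rk F i.+1, rk F i) :=
  map_mx (fun p : R => p@_0%MM) (diff F i).

Definition in_degree (F : free_complex) i (e : nat) (z : 'rV[k]_(rk F i)) :
    Prop :=
  forall a, z 0 a != 0 -> deg a = e.

(* The augmentation is not part of F (x)_R k: all of F_0 (x) k is cycles. *)
Definition cyclek (F : free_complex) i : 'rV[k]_(rk F i) -> Prop :=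
  match i with
  | 0 => fun _ => True
  | i'.+1 => fun z => z *m diffk F i' = 0
  end.

(* H_i(F (x)_R k)_e = 0 *)
Definition homologyk_vanishes (F : free_complex) (i e : nat) : Prop :=
  forall z : 'rV[k]_(rk F i), in_degree e z -> cyclek z ->
  exists w : 'rV[k]_(rk F i.+1), in_degree e w /\ z = w *m diffk F i.

(* Tor_i^R(J, k)_e = 0.  The homology does not depend on the resolution F, and
   every homogeneous ideal has one, so "exists" could as well be "for all". *)
Definition Tor_vanishes (J : R -> Prop) (i e : nat) : Prop :=
  exists F : free_complex,
    graded_free_resolution F J /\ homologyk_vanishes F i e.

(* The degree e = i + j ranges over nat, as Tor_i(J, k) lives in degrees >= 0,
   and j <> d reads e <> i + d. *)
Definition has_linear_resolution (J : R -> Prop) (d : nat) : Prop :=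
  forall i e : nat, e <> (i + d)%N -> Tor_vanishes J i e.

Definition componentwise_linear (I : R -> Prop) : Prop :=
  forall d : nat, has_linear_resolution (ideal_component I d) d.

End Graded.

(* Main.v *)
Require Import Defs.
From mathcomp Require Import all_boot all_order all_algebra.
From mathcomp Require Import mpoly.

Set Implicit Arguments.
Unset Strict Implicit.
Unset Printing Implicit Defensive.
Import GRing.Theory.
Local Open Scope ring_scope.

(** The graph is the three-page triangular book: two adjacent centres, each
    joined to three pairwise non-adjacent leaves.  It is chordal because a cycle
    of length at least 4 passes through a leaf, and the neighbours of a leaf are
    adjacent to each other ([simplicial_chord], [book_chordal]).

    The monomials of the ideal are the x^mu with mu_i + mu_j >= t on every edge.
    Write p, q for the centres and a, b, c for the leaves, and compare the
    generator x_p^t x_q^t of degree 2t with the generator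
    x_p^(t-1) x_q^(t-1) x_a x_b x_c of degree d = 2t+1 (it belongs to the ideal
    because t > 1).  Their lcm is x^m with m = (t, t, 1, 1, 1), of degree d+2.
    In the ideal J generated by the elements of degree d, no chain of linear
    relations below x^m connects the multiples of the one to the other, which
    gives a nonlinear first syzygy: Tor_1(J, k) is nonzero in degree d+2.

    For a monomial ideal J, the multidegree m part of Tor_1(J, k) is the reduced
    degree 0 homology of the graph on the variables x_i with x^m / x_i in J, in
    which x_i and x_j are joined when x^m / (x_i x_j) is in J.  Here every
    variable is a vertex, and no centre is joined to a leaf: taking one centre
    and one leaf off m leaves an edge of weight t-1.  [Tor1_nonvanishing] is the
    required half of that description: two variables in different parts of the
    graph give a nonzero class.

    The resolution that witnesses the vanishing of Tor_1 in one degree is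
    arbitrary, neither minimal nor multigraded, so nonvanishing is detected
    by a linear functional on its module F_0.  A function c on the variables that
    is constant on the components of the graph defines a functional [twisted]
    on F_0 whose value at x_i y is c(i) times the coefficient of x^m in
    x_i aug(y), for every i ([twistedXi]).  It vanishes on x_i y if y is in the
    kernel of the augmentation, but not on the syzygy between x^m / x_i and
    x^m / x_j when c(i) <> c(j). *)

(** * A functional that detects Tor_1 *)

Section TorOne.
Variables (k : fieldType) (n : nat).
Local Notation R := {mpoly k[n]}.
Implicit Types (p q : R) (m mu nu : 'X_{1..n}).

(** The coefficient of x^m in the product of q with the image of p under the
    diagonal operator x^mu |-> w(mu) x^mu. *)
Definition weighted_coeff (w : 'X_{1..n} -> k) m p q : k :=
  \sum_(h : 'X_{1..n < (mdeg m).+1, (mdeg m).+1} | m == (h.1 + h.2)%MM)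
    w h.1 * (p@_h.1 * q@_h.2).

Lemma weighted_coeffD w m p1 p2 q :
  weighted_coeff w m (p1 + p2) q =
  weighted_coeff w m p1 q + weighted_coeff w m p2 q.
Proof.
by rewrite -big_split; apply: eq_bigr => h _; rewrite mcoeffD mulrDl mulrDr.
Qed.

Lemma weighted_coeffZ w m a p q :
  weighted_coeff w m (a *: p) q = a * weighted_coeff w m p q.
Proof.
by rewrite mulr_sumr; apply: eq_bigr => h _; rewrite mcoeffZ -mulrA mulrCA.
Qed.

Lemma weighted_coeff_const w a m p q :
  (forall mu nu, (mu + nu)%MM = m -> p@_mu != 0 -> q@_nu != 0 -> w mu = a) ->
  weighted_coeff w m p q = a * (p * q)@_m.
Proof.
move=> wa; rewrite mcoeffM mulr_sumr; apply: eq_bigr => h /eqP mE.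
have [->|p0] := eqVneq p@_h.1 0; first by rewrite mul0r !mulr0.
have [->|q0] := eqVneq q@_h.2 0; first by rewrite !mulr0.
by rewrite (wa _ _ _ p0 q0).
Qed.

Lemma weighted_coeff_homog w m d e p q :
  p \is d.-homog -> q \is e.-homog -> mdeg m != (d + e)%N ->
  weighted_coeff w m p q = 0.
Proof.
move=> pd qe mde; rewrite (@weighted_coeff_const _ 0) ?mul0r // => mu nu mE pN qN.
case/negP: mde; rewrite -mE mdegD.
have /eqP -> : mdeg mu == d by apply: contraNT pN => /(dhomog_nemf_coeff pd)->.
by have /eqP -> : mdeg nu == e by apply: contraNT qN => /(dhomog_nemf_coeff qe)->.
Qed.

Lemma mcoeff_mulX0 i mu p : mu i = 0%N -> ('X_i * p)@_mu = 0.
Proof.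
move=> mui; rewrite mcoeffM big1 // => h /eqP muE; rewrite mcoeffX.
case: eqP => [hE|_]; last by rewrite mul0r.
have : mu i = (h.1 + h.2)%MM i by rewrite -muE.
by rewrite mui -hE mnmDE mnm1E eqxx.
Qed.

(** The choice of the variable that divides x^mu is immaterial under the
    hypothesis [hc] below.  The value 0 at mu = 0 keeps the functional blind to
    the constant parts of the coordinates. *)
Definition labelling (c : 'I_n -> bool) mu : k :=
  if [pick i | mu i != 0%N] is Some i then (c i)%:R else 0.

Section Functional.
Variables (r : nat) (h : 'cV[R]_r) (c : 'I_n -> bool) (m : 'X_{1..n}).
(* x_i and x_j count as joined once x^m / (x_i x_j) is in the support of some
   multiple of an entry of h, and c is constant along such joins. *)
Hypothesis hc : forall b p i j mu, (mu + U_(i) + U_(j) = m)%MM ->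
  (p * h b 0)@_mu != 0 -> c i = c j.

Definition twisted (y : 'rV[R]_r) : k :=
  \sum_b weighted_coeff (labelling c) m (y 0 b) (h b 0).

Lemma twistedD y1 y2 : twisted (y1 + y2) = twisted y1 + twisted y2.
Proof.
by rewrite -big_split; apply: eq_bigr => b _; rewrite mxE weighted_coeffD.
Qed.

Lemma twistedZ a y : twisted (a%:MP *: y) = a * twisted y.
Proof.
rewrite mulr_sumr; apply: eq_bigr => b _.
by rewrite mxE mul_mpolyC weighted_coeffZ.
Qed.

Lemma twisted0 : twisted 0 = 0.
Proof. by have := twistedZ 0 0; rewrite scaler0 mul0r. Qed.

Lemma twistedB y1 y2 : twisted (y1 - y2) = twisted y1 - twisted y2.
Proof. by rewrite twistedD -scaleN1r -mpolyC1 -mpolyCN twistedZ mulN1r. Qed.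

Lemma twisted_sum (I : Type) (s : seq I) (y : I -> 'rV[R]_r) :
  twisted (\sum_(l <- s) y l) = \sum_(l <- s) twisted (y l).
Proof. exact: (big_morph _ twistedD twisted0). Qed.

(** Every monomial of a coordinate of x_i y is divisible by x_i.  If its label is
    read off another variable x_j instead, then it is divisible by x_i x_j,
    and, if it contributes to x^m, this joins x_i and x_j in the graph, so that
    the label is c(i) anyway. *)
Lemma twistedXi i y :
  twisted ('X_i *: y) = (c i)%:R * ('X_i * (y *m h) 0 0)@_m.
Proof.
rewrite mxE !mulr_sumr raddf_sum mulr_sumr; apply: eq_bigr => b _ /=.
rewrite mxE mulrA; apply: weighted_coeff_const => mu nu mE.
have [mui|mui] := eqVneq (mu i) 0%N.
  by rewrite mcoeff_mulX0 ?eqxx.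
move=> _ q0; rewrite /labelling.
case: pickP => [j muj|/(_ i)]; last by rewrite mui.
have [->//|ij] := eqVneq j i.
(* The witness: x^s times the generator has x^m / (x_i x_j) in its support. *)
pose s := (mu - U_(i) - U_(j))%MM.
have sE : (s + U_(j) + U_(i) = mu)%MM.
  apply/mnmP => l; rewrite !mnmDE !mnmBE !mnm1E.
  have [<-|li] := eqVneq i l; last have [<-|lj] := eqVneq j l.
  - by rewrite (negPf ij) /= addn0 subn0 subnK // lt0n.
  - by rewrite /= addn0 subn0 subnK // lt0n.
  - by rewrite /= !subn0 !addn0.
congr (_%:R); congr nat_of_bool.
apply: (hc (b := b) (p := 'X_[s]) (mu := (s + nu)%MM)).
  apply/mnmP => l; rewrite -mE -sE !mnmDE [RHS]addnAC; congr addn.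
  exact: addnAC.
by rewrite mulrC mcoeffMX.
Qed.

(** On multiples of a syzygy only the constant term of the factor survives, as
    every other monomial has a variable to which [twistedXi] applies. *)
Lemma twistedZ_ker p (y : 'rV[R]_r) :
  y *m h = 0 -> twisted (p *: y) = p@_0%MM * twisted y.
Proof.
move=> yh; elim/mpolyind: p => [|a mu p _ _ IHp].
  by rewrite scale0r twisted0 mcoeff0 mul0r.
rewrite scalerDl twistedD IHp mcoeffD mulrDl; congr (_ + _).
rewrite -mul_mpolyC -scalerA twistedZ mul_mpolyC mcoeffZ -mulrA; congr (_ * _).
rewrite mcoeffX; have [->|mu0] := eqVneq mu 0%MM.
  by rewrite mpolyX0 scale1r mul1r.
have [i mui] : exists i, mu i != 0%N.
  apply/existsP; apply: contraNT mu0 => /existsPn mu0.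
  by apply/eqP/mnmP => i; rewrite mnm0E; apply/eqP/negPn/mu0.
rewrite mul0r -(submK (_ : (U_(i) <= mu)%MM)) ?lep1mP // addmC mpolyXD.
by rewrite -scalerA twistedXi -scalemxAl yh scaler0 mxE mulr0 mcoeff0 mulr0.
Qed.

Lemma twisted_homog e (y : 'rV[R]_r) (dg : 'I_r -> nat) :
  (forall b, h b 0 \is (dg b).-homog) ->
  (forall b, if (dg b <= e)%N then y 0 b \is (e - dg b).-homog else y 0 b == 0) ->
  mdeg m != e -> twisted y = 0.
Proof.
move=> hd yd me; apply: big1 => b _; have := yd b; case: leqP => [le yb|_ /eqP->].
  by apply: (weighted_coeff_homog _ yb (hd b)); rewrite subnK.
by rewrite -(scale0r 0) weighted_coeffZ mul0r.
Qed.

End Functional.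

(** Multiply lifts of x^m / x_i and x^m / x_j to F_0 by x_i and x_j: the
    difference kappa is a syzygy with coordinates in the maximal ideal.  If
    H_1(F (x) k) vanishes in the degree of m, then kappa = sum_a w'_a d_a, with
    d_a the rows of the first differential and with no constant term in w'_a for
    a in that degree.  The functional then kills every summand, either because
    w'_a has no constant term or because d_a has the wrong degree, whereas its
    value at kappa is c(i) - c(j). *)
Lemma Tor1_nonvanishing (J : R -> Prop) (c : 'I_n -> bool) m mi mj i j :
  (mi + U_(i))%MM = m -> (mj + U_(j))%MM = m ->
  J 'X_[mi] -> J 'X_[mj] -> c i != c j ->
  (forall f u v mu, J f -> f@_mu != 0 -> (mu + U_(u) + U_(v))%MM = m ->
     c u = c v) ->
  ~ Tor_vanishes J 1 (mdeg m).
Proof.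
move=> miE mjE /= Ji Jj cij hJ [F [[[gr_aug gr_diff] imJ ex0 ex1] H1]].
set e := mdeg m in H1.
have hc b p u v mu : (mu + U_(u) + U_(v) = m)%MM ->
    (p * aug F b 0)@_mu != 0 -> c u = c v.
  move=> muE fmu; apply: hJ fmu muE; apply/imJ; exists (p *: delta_mx 0 b).
  by rewrite -scalemxAl -rowE !mxE.
have [vi viE] := (imJ _).1 Ji; have [vj vjE] := (imJ _).1 Jj.
pose kappa : 'rV[R]_(rk F 0) := 'X_i *: vi - 'X_j *: vj.
have kappa_aug : kappa *m aug F = 0.
  apply/matrixP => a b; rewrite !ord1 mulmxBl -!scalemxAl.
  transitivity ('X_i * (vi *m aug F) 0 0 - 'X_j * (vj *m aug F) 0 0).
    by rewrite !mxE.
  rewrite viE vjE mxE; by rewrite -!mpolyXD ![(U_(_) + _)%MM]addmC miE mjE subrr.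
have [w wE] := (ex0 _).1 kappa_aug.
have kappa0 b : (kappa 0 b)@_0%MM = 0.
  by rewrite !mxE mcoeffB !mcoeff_mulX0 ?mnm0E // subrr.
(* The lift w need not be homogeneous: z is its part of degree e modulo the
   maximal ideal. *)
pose z : 'rV[k]_(rk F 1) :=
  \row_a (if deg a == e then (w 0 a)@_0%MM else 0).
have diffk_deg (a : 'I_(rk F 1)) (b : 'I_(rk F 0)) :
    deg a != deg b -> (diff F 0 a b)@_0%MM = 0.
  move=> ab; have := gr_diff 0%N a b; case: leqP => [le hom|_ /eqP->]; last first.
    by rewrite mcoeff0.
  apply: (dhomog_nemf_coeff hom).
  rewrite [X in X != _](@mdeg0 n) eq_sym subn_eq0 -ltnNge.
  by rewrite ltn_neqAle eq_sym ab.
have zZ : cyclek z.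
  apply/matrixP => a b; rewrite ord1 mxE [RHS]mxE.
  have [be|be] := eqVneq (deg b) e; last first.
    apply: big1 => l _; rewrite !mxE; have [le|_] := eqVneq (deg l) e; last first.
      by rewrite mul0r.
    by rewrite diffk_deg ?mulr0 // le eq_sym.
  rewrite -[RHS](kappa0 b) -wE mxE raddf_sum; apply: eq_bigr => l _.
  rewrite !mxE [RHS](rmorphM (mcoeff 0%MM)) /=.
  by have [//|le] := eqVneq (deg l) e; rewrite diffk_deg ?mulr0 // be.
have [|y [_ yE]] := H1 z _ zZ.
  by move=> a; rewrite mxE; have [//|_] := eqVneq (deg a) e; rewrite eqxx.
(* Correcting w by a boundary removes its constant terms in degree e. *)
pose w' := w - map_mx (mpolyC n (R:=k)) y *m diff F 1.
have w'E : w' *m diff F 0 = kappa.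
  by rewrite mulmxBl wE ((ex1 0%N _).2 (ex_intro _ _ erefl)) subr0.
have w'0 a : deg a = e -> (w' 0 a)@_0%MM = 0.
  move=> ae; rewrite mxE mcoeffD [X in _ + X@__]mxE mcoeffN.
  have := congr1 (fun v : 'rV_ _ => v 0 a) yE.
  rewrite mxE ae eqxx => ->; rewrite !mxE raddf_sum /=.
  apply/eqP; rewrite subr_eq0; apply/eqP/eq_bigr => l _.
  by rewrite !mxE mcoeffCM.
have : twisted (aug F) c m kappa = 0.
  rewrite -w'E mulmx_sum_row twisted_sum big1 // => a _.
  have rowK : row a (diff F 0) *m aug F = 0.
    by apply/ex0; exists (delta_mx 0 a); rewrite rowE.
  rewrite (twistedZ_ker hc) //.
  have [/w'0->|ae] := eqVneq (deg a) e; first by rewrite mul0r.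
  rewrite (twisted_homog (e := deg a) _ gr_aug) ?mulr0 // 1?eq_sym //.
  by move=> b; rewrite mxE; apply: gr_diff.
rewrite twistedB !(twistedXi hc) viE vjE -!mpolyXD ![(U_(_) + _)%MM]addmC miE mjE.
rewrite mcoeffX eqxx !mulr1; case: (c i) (c j) cij => [] [] //= _ /eqP.
  by rewrite subr0 oner_eq0.
by rewrite sub0r oppr_eq0 oner_eq0.
Qed.

End TorOne.

(** * Monomials in the intersection of the powers of the edge ideals *)

Section EdgeIdeals.
Variables (k : fieldType) (n : nat).
Local Notation R := {mpoly k[n]}.
Implicit Types (f g : R) (mu : 'X_{1..n}).

Lemma ideal_gen_mem (A : comNzRingType) (S : A -> Prop) (a f : A) :
  S f -> ideal_gen S (a * f).
Proof.
move=> Sf; exists 1%N, (fun=> a), (fun=> f); split=> //.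
by rewrite big_ord1.
Qed.

Section Order.
Variables i j : 'I_n.

(** Every monomial of f has degree at least s in x_i and x_j. *)
Definition order_ge (s : nat) f :=
  forall mu, f@_mu != 0 -> (s <= mu i + mu j)%N.

Lemma order_geM s1 s2 f g :
  order_ge s1 f -> order_ge s2 g -> order_ge (s1 + s2) (f * g).
Proof.
move=> fs gs mu; apply: contraR; rewrite -ltnNge => mus.
rewrite mcoeffM big1 // => h /eqP muE.
have [->|/fs f1] := eqVneq f@_h.1 0; first by rewrite mul0r.
have [->|/gs g1] := eqVneq g@_h.2 0; first by rewrite mulr0.
have mE l : mu l = (h.1 + h.2)%MM l by rewrite -muE.
move: mus; rewrite !mE !mnmDE addnACA ltnNge => /negP[]; exact: leq_add.
Qed.

Lemma order_ge_ideal (S : R -> Prop) s f :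
  (forall g, S g -> order_ge s g) -> ideal_gen S f -> order_ge s f.
Proof.
move=> Ss [l [a [g [Sg ->]]]] mu; rewrite raddf_sum /=.
apply: contraR => mus; rewrite big1 // => u _.
apply/eqP; apply: contraR mus.
by apply: (@order_geM 0) => //; apply: Ss.
Qed.

Lemma ideal_pow_order t f :
  ideal_pow (ideal_gen (fun g : R => g = 'X_i \/ g = 'X_j)) t f -> order_ge t f.
Proof.
apply: order_ge_ideal => _ [g [gI ->]].
have: forall l, order_ge 1 (g l).
  move=> l; apply: order_ge_ideal (gI l) => g' gX mu.
  case: gX => ->; rewrite mcoeffX;
    (have [<- _|_] := eqVneq _ mu; last by rewrite eqxx); rewrite !mnm1E eqxx.
    by rewrite leq_addr.
  by rewrite leq_addl.
move: {gI} g; elim: t => [|t IHt] g g1; first by move=> mu _.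
by rewrite big_ord_recl; apply: (order_geM (s1 := 1)) (IHt _ _) => // l.
Qed.

(** One factor at a time is split off x^mu.  The vertices have to be distinct:
    for i = j the bound only says that 2 mu_i >= t. *)
Lemma ideal_pow_mpolyX t mu : i != j -> (t <= mu i + mu j)%N ->
  ideal_pow (ideal_gen (fun g : R => g = 'X_i \/ g = 'X_j)) t 'X_[mu].
Proof.
move=> ij tmu; set S := fun g : R => _.
suff [a [g [gS ->]]] : exists a (g : 'I_t -> R),
    (forall l, ideal_gen S (g l)) /\ 'X_[mu] = a * \prod_l g l.
  by apply: ideal_gen_mem; exists g.
elim: t mu tmu => [|t IHt] mu tmu.
  exists 'X_[mu], (fun=> 0); rewrite big_ord0 mulr1; split=> //.
  by case.
have [u [uS mu_u tu]] : exists u, [/\ S 'X_u, mu u != 0%N &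
    (t <= (mu - U_(u))%MM i + (mu - U_(u))%MM j)%N].
  have [mui|mui] := eqVneq (mu i) 0%N.
    exists j; rewrite !mnmBE !mnm1E eqxx (eq_sym j) (negPf ij); split.
    - by right.
    - by move: tmu; rewrite mui; case: (mu j).
    - by move: tmu; rewrite mui; case: (mu j) => // l; rewrite subn1.
  exists i; rewrite !mnmBE !mnm1E eqxx (negPf ij); split=> //; first by left.
  by move: tmu mui; case: (mu i) => // l; rewrite subn1 subn0.
have [a [g [gS muE]]] := IHt _ tu.
exists a, (fun l => if unlift ord0 l is Some l' then g l' else 'X_u); split.
  move=> l; case: unliftP => [l' _|_]; first exact: gS.
  by rewrite -[X in ideal_gen _ X]mul1r; apply: ideal_gen_mem.
rewrite big_ord_recl unlift_none.
under eq_bigr do rewrite liftK.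
by rewrite mulrCA -muE -mpolyXD addmC submK // lep1mP.
Qed.

End Order.

Lemma component_order (E : rel 'I_n) t d f i j : E i j ->
  ideal_component (edge_ideal_pow_inter E t) d f -> order_ge i j t f.
Proof.
move=> Eij; apply: order_ge_ideal => g [gI _]; exact/ideal_pow_order/gI.
Qed.

Lemma component_mpolyX (E : rel 'I_n) t mu nu : irreflexive E ->
  (forall i j, E i j -> (t <= mu i + mu j)%N) ->
  ideal_component (edge_ideal_pow_inter (k := k) E t) (mdeg mu) 'X_[nu + mu].
Proof.
move=> irrE Emu; rewrite mpolyXD; apply: ideal_gen_mem; split; last first.
  by rewrite dhomogX.
move=> i j Eij; apply: ideal_pow_mpolyX (Emu _ _ Eij).
by apply: contraTneq Eij => ->; rewrite irrE.
Qed.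

End EdgeIdeals.

(** * Chordality of the book graph *)

(** The two neighbours of a simplicial vertex on the cycle are adjacent, and not
    consecutive on the cycle as this would close it up as a triangle. *)
Lemma simplicial_chord (T : finType) (E : rel T) (c : seq T) x :
  ssrbool.symmetric E -> uniq c -> cycle E c -> (4 <= size c)%N -> x \in c ->
  (forall y z, E x y -> E x z -> y != z -> E y z) ->
  exists y z, [/\ y \in c, z \in c, E y z, z != next c y & y != next c z].
Proof.
move=> symE; wlog: c / exists s, c = x :: s.
  move=> IH Uc Ec sc xc simp; have [u s cE] := rot_to xc.
  have memE := mem_rot u c.
  have [||||||y [z]] := IH (rot u c) => //.
  - by exists s.
  - by rewrite rot_uniq.
  - by rewrite rot_cycle.
  - by rewrite size_rot.
  - by rewrite memE.
  by rewrite !next_rot // !memE; exists y, z.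
case=> [[|y [|y' s]]] -> //; case: (lastP s) => // {}s z Uc Ec _ _ simp.
have /andP[xc /andP[yc /andP[y'c _]]] := Uc.
have zx : E x z.
  by rewrite symE; move: Ec; rewrite /= rcons_path last_rcons; case/and4P.
have xy : E x y by move: Ec; rewrite /=; case/andP.
have yz : y != z by apply: contraNneq yc => ->; rewrite inE mem_rcons mem_head orbT.
have zy' : z != y' by apply: contraNneq y'c => <-; rewrite mem_rcons mem_head.
have zxN : z != x by apply: contraNneq xc => <-; rewrite !inE mem_rcons mem_head !orbT.
have yxN : y != x by apply: contraNneq xc => <-; rewrite mem_head.
exists y, z; split.
- by rewrite !inE eqxx orbT.
- by rewrite !inE mem_rcons mem_head !orbT.
- exact: simp.
- by rewrite /= (negPf yxN) eqxx.
rewrite next_nth !inE mem_rcons mem_head !orbT nth_default //.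
have zs : z \notin s.
  by move: Uc; rewrite -!rcons_cons rcons_uniq !inE !negb_or => /andP[/and4P[]].
rewrite /= (negPf yz) (eq_sym y') (negPf zy') -cats1 index_cat (negPf zs) /= eqxx.
by rewrite (eq_sym x) (negPf zxN) size_cat addn0 addn1.
Qed.

(** Vertices 0 and 1 are the centres, and 2, 3, 4 the leaves. *)
Definition book_edge : rel 'I_5 :=
  fun i j => (i != j) && ((i < 2)%N || (j < 2)%N).

Lemma book_edge_sym : ssrbool.symmetric book_edge.
Proof. by move=> i j; rewrite /book_edge eq_sym orbC. Qed.

Lemma book_edge_irr : irreflexive book_edge.
Proof. by move=> i; rewrite /book_edge eqxx. Qed.

(** A duplicate-free cycle of length at least 4 cannot consist of the two centres
    only, and leaves are simplicial. *)
Lemma book_chordal : chordal book_edge.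
Proof.
move=> c Uc Ec sc.
have [x xc x2] : exists2 x, x \in c & (2 <= x)%N.
  apply/hasP; apply: contraTT sc => /hasPn c2; rewrite -ltnNge ltnS.
  have /uniq_leq_size : uniq [seq val x | x <- c].
    by rewrite map_inj_uniq //; apply: val_inj.
  move=> /(_ (iota 0 2)); rewrite size_map size_iota => le2.
  apply: leq_trans (le2 _) _ => // _ /mapP[x /c2 x2 ->].
  by rewrite mem_iota add0n /= ltnNge.
apply: (simplicial_chord book_edge_sym Uc Ec sc xc) => y z /andP[_ xy] /andP[_ _] yz.
by move: xy; rewrite /book_edge yz ltnNge x2 /= => ->.
Qed.

(** * The component of degree 2t+1 has a nonlinear first syzygy *)

Theorem mainTheorem2 (k : fieldType) :
  exists (n : nat) (E : rel 'I_n),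
    [/\ ssrbool.symmetric E, irreflexive E, chordal E
      & forall t : nat, (1 < t)%N ->
          ~ componentwise_linear (@edge_ideal_pow_inter k n E t)].
Proof.
exists 5%N, book_edge; split.
- exact: book_edge_sym.
- exact: book_edge_irr.
- exact: book_chordal.
move=> t t1 lin.
(* mono a b c has exponent a at both centres and 1, b, c at the leaves. *)
pose mono (a b c : nat) : 'X_{1..5} :=
  [multinom nth 0%N [:: a; a; 1%N; b; c] l | l < 5].
have mono_deg a b c : mdeg (mono a b c) = (a + a + (1 + b + c))%N.
  by rewrite mdegE !big_ord_recl big_ord0 !mnmE /= addn0 !addnA.
pose m := mono t 1%N 1%N; pose d := t.*2.+1.
have memJ mu nu : mdeg mu = d ->
    (forall i j, book_edge i j -> (t <= mu i + mu j)%N) ->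
    ideal_component (edge_ideal_pow_inter (k := k) book_edge t) d 'X_[nu + mu].
  by move=> <-; apply/component_mpolyX/book_edge_irr.
(* A centre and a leaf are not joined: at x^m / (x_u x_v) the edge from u to v
   has weight t - 1. *)
have cross f mu u v :
    ideal_component (edge_ideal_pow_inter (k := k) book_edge t) d f ->
    f@_mu != 0 -> (mu + U_(u) + U_(v))%MM = m ->
    (u < 2)%N -> (2 <= v)%N -> False.
  move=> Jf fmu muE u2 v2.
  have uv : u != v by apply: contraTneq u2 => ->; rewrite -leqNgt.
  have Euv : book_edge u v by rewrite /book_edge uv u2.
  have := component_order Euv Jf fmu.
  have mu_u : (mu u + 1)%N = t.
    have := congr1 (fun x : 'X_{1..5} => x u) muE.
    rewrite !mnmDE !mnm1E eqxx eq_sym (negPf uv) addn0 mnmE => ->.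
    by case: u u2 {uv Euv muE} => [[|[|]]].
  have mu_v : (mu v + 1)%N = 1%N.
    have := congr1 (fun x : 'X_{1..5} => x v) muE.
    rewrite !mnmDE !mnm1E eqxx (negPf uv) addn0 mnmE => ->.
    by case: v v2 {uv Euv muE} => [[|[|[|[|[|]]]]]].
  move/eqP: mu_v; rewrite addn1 eqSS => /eqP ->.
  by rewrite addn0 -{1}mu_u addn1 ltnn.
(* x^m / x_0 is a multiple of x_0^(t-1) x_1^(t-1) x_2 x_3 x_4. *)
have miE : (U_(lift ord0 ord0) + mono t.-1 1%N 1%N + U_(ord0))%MM = m.
  apply/mnmP => -[[|[|[|[|[|l]]]]] hl] //; rewrite !mnmDE !mnm1E !mnmE //=.
    by rewrite add0n addn1 prednK // ltnW.
  by rewrite addn0 add1n prednK // ltnW.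
(* x^m / x_4 is a multiple of x_0^t x_1^t; the factor x_2 in mono t 0 0 brings
   the degree to d. *)
have mjE : (U_(Ordinal (isT : (3 < 5)%N)) + mono t 0%N 0%N + U_(ord_max))%MM = m.
  apply/mnmP => -[[|[|[|[|[|l]]]]] hl] //; rewrite !mnmDE !mnm1E !mnmE //=.
    by rewrite addn0.
  by rewrite addn0.
apply: (Tor1_nonvanishing (c := fun i => (i < 2)%N) miE mjE _ _ _ _
  (lin d 1%N (mdeg m) _)) => //.
- apply: memJ.
    by rewrite mono_deg /d; case: (t) t1 => // l _; rewrite /= addnn addn3.
  case: (t) t1 => [|[|l]] // _.
  move=> [[|[|[|[|[|i]]]]] hi] [[|[|[|[|[|j]]]]] hj] //= _;
    by rewrite !mnmE /= ?addn1 ?add1n // addSnnS leq_addl.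
- apply: memJ; first by rewrite mono_deg /d addnn addn1.
  move=> [[|[|[|[|[|i]]]]] hi] [[|[|[|[|[|j]]]]] hj] //= _;
    by rewrite !mnmE /= ?leq_addl ?leq_addr.
- move=> f u v mu Jf fmu muE.
  have muE' : (mu + U_(v) + U_(u))%MM = m.
    by rewrite -muE; apply/mnmP => l; rewrite !mnmDE addnAC.
  case: (ltnP u 2) => hu; case: (ltnP v 2) => hv //.
  + by case: (cross f mu u v).
  + by case: (cross f mu v u).
rewrite mono_deg /d addnn addn3 add1n => /eqP.
by rewrite !eqSS gtn_eqF.
Qed.
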